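(* Let $G$ be a non-elementary hyperbolic group and let $A\subseteq G$ be a finite union of conjugacy classes in $G$. If the set $A$ is infinite, then $A$ is not quasiconvex in $G$.
   Context: A finitely generated group $G$ is hyperbolic if its Cayley graph $\Gamma(G,\mathcal{A})$ with respect to some (equivalently, any) finite symmetrized generating set $\mathcal{A}=\mathcal{A}^{-1}$ is a Gromov hyperbolic metric space. A group is non-elementary if it is not virtually cyclic. A subset $Q\subseteq G$ is $\varepsilon$-quasiconvex ($\varepsilon\ge 0$) if every geodesic in $\Gamma(G,\mathcal{A})$ connecting two elements of $Q$ lies in the closed $\varepsilon$-neighborhood of $Q$; $Q$ is quasiconvex if it is $\varepsilon$-quasiconvex for some $\varepsilon$ (for hyperbolic $G$ this does not depend on the choice of the finite generating set). *)

(* Defs.v *)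
From HB Require Import structures.
From mathcomp Require Import all_boot all_order all_algebra.
From mathcomp Require Import all_classical all_reals all_analysis.

Set Implicit Arguments.
Unset Strict Implicit.
Unset Printing Implicit Defensive.

Import Order.TTheory GRing.Theory Num.Theory.

Local Open Scope classical_set_scope.
Local Open Scope ring_scope.

Section MetricNotions.
Context {R : realType} (X : metricType R).
Implicit Types x y z w : X.

Definition gromov_product x y w : R :=
  (mdist x w + mdist y w - mdist x y) / 2.

Definition gromov_hyperbolic : Prop :=
  exists2 delta : R, 0 <= delta & forall x y z w,
    Num.min (gromov_product x z w) (gromov_product z y w) - delta
      <= gromov_product x y w.

(* Only the values of [p] on [0, l] matter. *)
Definition geodesic (p : R -> X) (l : R) x y : Prop :=
  [/\ 0 <= l, p 0 = x, p l = y &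
    {in `[0, l] &, forall s t, mdist (p s) (p t) = `|s - t|}].

Definition closed_neighborhood (eps : R) (Q : set X) : set X :=
  [set z | exists2 q, Q q & mdist z q <= eps].

End MetricNotions.

Record generating_set (G : groupType) := GeneratingSet {
  gens : set G;
  gens_finite : finite_set gens;
  gens_sym : forall s, gens s -> gens (s^-1)%g;
  gens_generate : forall g, exists2 w : seq G,
    {in w, forall s, gens s} & g = (\prod_(s <- w) s)%g }.

Section CayleyGraph.
Context (R : realType) (G : groupType).

(* Points of the geometric realization are given by their barycentric
   coordinates: this is the point at distance [s] from [a] on the edge joining
   [a] to [b]. It is the vertex [a] when [s = 0] or [a = b], so a loop
   (present when [1] is a generator) is collapsed to its vertex and the edges
   (a, b) and (b, a) coincide. *)
Definition edge_point (a b : G) (s : R) : G -> R :=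
  fun k => (1 - s) * (k == a)%:R + s * (k == b)%:R.

Variable S : generating_set G.

Definition cayley_points : set (G -> R) :=
  [set x | exists a b s,
    [/\ a = b \/ gens S (a^-1 * b)%g, 0 <= s <= 1 & x = edge_point a b s]].

(* Piecewise linear paths; each step stays inside one closed edge. The last
   argument is the length. *)
Inductive edge_path : (G -> R) -> (G -> R) -> R -> Prop :=
| edge_path_nil x : edge_path x x 0
| edge_path_cons a b s t y l :
    gens S (a^-1 * b)%g -> 0 <= s <= 1 -> 0 <= t <= 1 ->
    edge_path (edge_point a b t) y l ->
    edge_path (edge_point a b s) y (`|s - t| + l).

Definition edge_path_dist (x y : G -> R) : R :=
  inf [set l | edge_path x y l].

Definition cayley_graph : Type := cayley_points.

HB.instance Definition _ := Choice.on cayley_graph.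

Lemma edge_pointC a b s : edge_point a b s = edge_point b a (1 - s).
Proof.
by apply/funext => k; rewrite /edge_point subKr addrC.
Qed.

Lemma edge_point0 a b : edge_point a b 0 = edge_point a a 0.
Proof. by apply/funext => k; rewrite /edge_point !mul0r. Qed.

Lemma edge_point1 a b : edge_point a b 1 = edge_point b b 0.
Proof. by rewrite edge_pointC subrr edge_point0. Qed.

Lemma edge_point_self a s : edge_point a a s = edge_point a a 0.
Proof.
by apply/funext => k; rewrite /edge_point -!mulrDl !subrK.
Qed.

Lemma edge_path_ge0 x y l : edge_path x y l -> 0 <= l.
Proof. by elim=> // *; apply: addr_ge0. Qed.

Lemma edge_path_cat x y z l m :
  edge_path x y l -> edge_path y z m -> edge_path x z (l + m).
Proof.
elim=> {x y l} [x|a b s t y l Sab s01 t01 _ IH] yz; first by rewrite add0r.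
by rewrite -addrA; apply: edge_path_cons => //; apply: IH.
Qed.

Lemma edge_path1 a b s t : gens S (a^-1 * b)%g -> 0 <= s <= 1 -> 0 <= t <= 1 ->
  edge_path (edge_point a b s) (edge_point a b t) `|s - t|.
Proof.
by move=> Sab s01 t01; rewrite -[`|_|]addr0; apply: edge_path_cons => //;
  apply: edge_path_nil.
Qed.

Lemma edge_path_rev x y l : edge_path x y l -> edge_path y x l.
Proof.
elim=> {x y l} [x|a b s t y l Sab s01 t01 _ IH]; first exact: edge_path_nil.
by rewrite addrC distrC; apply: edge_path_cat IH (edge_path1 _ _ _).
Qed.

Lemma edge_point_coord a b s t k :
  `|edge_point a b s k - edge_point a b t k| <= `|s - t|.
Proof.
rewrite /edge_point; case: (k == a); case: (k == b).
- by rewrite !mulr1 !subrK subrr normr0.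
- by rewrite !mulr1 !mulr0 !addr0 opprB addrC subrKA distrC.
- by rewrite !mulr1 !mulr0 !add0r.
- by rewrite !mulr0 addr0 subrr normr0.
Qed.

Lemma edge_path_coord x y l k : edge_path x y l -> `|x k - y k| <= l.
Proof.
elim=> {x y l} [x|a b s t y l _ _ _ _ IH]; first by rewrite subrr normr0.
rewrite (le_trans (ler_distD (edge_point a b t k) _ _))// lerD//.
exact: edge_point_coord.
Qed.

Lemma edge_path_vertices a b :
  exists l, edge_path (edge_point a a 0) (edge_point b b 0) l.
Proof.
have [w Sw] := gens_generate S (a^-1 * b)%g.
elim: w a Sw => [|c w IH] a Sw.
  rewrite big_nil => ab1.
  have -> : b = a by rewrite -[b](mulVKg a) ab1 mulg1.
  by exists 0; apply: edge_path_nil.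
rewrite big_cons => abE.
have [||l pl] := IH (a * c)%g.
- by move=> s sw; apply: Sw; rewrite inE sw orbT.
- by rewrite invgM -mulgA abE mulKg.
exists (`|0 - 1| + l); rewrite -(edge_point0 a (a * c)%g).
apply: edge_path_cons => //; rewrite ?lexx ?ler01 //.
  by rewrite mulKg; apply: Sw; rewrite inE eqxx.
by rewrite edge_point1.
Qed.

Lemma edge_path_to_vertex x : cayley_points x ->
  exists a l, edge_path x (edge_point a a 0) l.
Proof.
move=> [a [b [s [[->|Sab] s01 ->]]]].
  by exists b, 0; rewrite edge_point_self; apply: edge_path_nil.
exists a, `|s - 0|; rewrite -(edge_point0 a b).
by apply: edge_path1 => //; rewrite lexx ler01.
Qed.

Lemma edge_path_exists x y : cayley_points x -> cayley_points y ->
  [set l | edge_path x y l] !=set0.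
Proof.
move=> /edge_path_to_vertex[a [l xa]] /edge_path_to_vertex[b [m yb]].
have [n ab] := edge_path_vertices a b.
exists (l + (n + m)); apply: edge_path_cat xa _.
by apply: edge_path_cat ab _; apply: edge_path_rev.
Qed.

Lemma edge_path_lbound x y : has_lbound [set l | edge_path x y l].
Proof. by exists 0 => l /edge_path_ge0. Qed.

Lemma edge_path_distxx x : edge_path_dist x x = 0.
Proof.
apply/le_anti/andP; split.
  exact: ge_inf (edge_path_lbound x x) _ (edge_path_nil x).
by apply: lb_le_inf => [|l /edge_path_ge0 //]; exists 0; apply: edge_path_nil.
Qed.

Lemma edge_path_distC x y : edge_path_dist x y = edge_path_dist y x.
Proof.
by congr inf; apply/seteqP; split=> l; apply: edge_path_rev.
Qed.

Definition cayley_dist (x y : cayley_graph) : R :=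
  edge_path_dist (val x) (val y).

Lemma cayley_pathsP (x y : cayley_graph) :
  [set l | edge_path (val x) (val y) l] !=set0.
Proof. by apply: edge_path_exists; apply/set_mem/valP. Qed.

Lemma cayley_distxx x : cayley_dist x x = 0.
Proof. exact: edge_path_distxx. Qed.

Lemma cayley_distC x y : cayley_dist x y = cayley_dist y x.
Proof. exact: edge_path_distC. Qed.

Lemma cayley_dist_positivity x y : cayley_dist x y = 0 -> x = y.
Proof.
move=> d0; apply/val_inj/funext => k; apply/subr0_eq/normr0_eq0.
apply/le_anti; rewrite normr_ge0 andbT -d0.
by apply: lb_le_inf (cayley_pathsP x y) _ => l; apply: edge_path_coord.
Qed.

Lemma cayley_dist_triangle y x z :
  cayley_dist x z <= cayley_dist x y + cayley_dist y z.
Proof.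
rewrite -lerBlDr; apply: lb_le_inf (cayley_pathsP x y) _ => l xy.
rewrite lerBlDr -lerBlDl; apply: lb_le_inf (cayley_pathsP y z) _ => m yz.
rewrite lerBlDl; apply: ge_inf (edge_path_lbound _ _) _ _.
exact: edge_path_cat xy yz.
Qed.

HB.instance Definition _ := isMetric.Build R cayley_graph
  cayley_distxx cayley_dist_positivity cayley_distC cayley_dist_triangle.

Lemma vertex_subproof (g : G) : edge_point g g 0 \in cayley_points.
Proof.
by apply/mem_set; exists g, g, 0; split; [left|rewrite lexx ler01|].
Qed.

Definition vertex (g : G) : cayley_graph := SigSub (vertex_subproof g).

Definition eps_quasiconvex (eps : R) (Q : set G) : Prop :=
  forall (g h : G) (p : R -> cayley_graph) (l : R),
    Q g -> Q h -> geodesic p l (vertex g) (vertex h) ->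
    p @` `[0, l] `<=` closed_neighborhood eps (vertex @` Q).

Definition quasiconvex (Q : set G) : Prop :=
  exists2 eps : R, 0 <= eps & eps_quasiconvex eps Q.

End CayleyGraph.

Definition hyperbolic_group (R : realType) (G : groupType) : Prop :=
  exists S : generating_set G, gromov_hyperbolic (cayley_graph R S).

Section GroupNotions.
Context (G : groupType).

Definition cyclic_subgroup (c : G) : set G :=
  [set g | exists n : nat, g = (c ^+ n)%g \/ g = (c ^- n)%g].

Definition finite_index (H : set G) : Prop :=
  finite_set (range (fun g : G => [set (g * h)%g | h in H])).

Definition virtually_cyclic : Prop :=
  exists c : G, finite_index (cyclic_subgroup c).

Definition conjugacy_class (x : G) : set G := range (fun g : G => (x ^ g)%g).

Definition finite_union_of_conjugacy_classes (A : set G) : Prop :=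
  exists2 F : set G, finite_set F & A = \bigcup_(x in F) conjugacy_class x.

End GroupNotions.

Definition non_elementary (G : groupType) : Prop := ~ virtually_cyclic G.

(* Main.v *)
Require Import Defs.
From mathcomp Require Import all_boot all_order all_algebra.
From mathcomp Require Import all_classical all_reals all_analysis.
From mathcomp Require Import zify lra finmap.

(** Let [T] be a finite generating set whose Cayley graph is hyperbolic, [d]
    its word metric and [len] its word length, and let [A] be infinite,
    quasiconvex and a finite union of conjugacy classes. The proof shows that
    [G] is virtually cyclic.

    An element [a] of [A] is conjugate to one of finitely many elements, so it
    moves some point by a bounded amount. Sliding that point towards [1]
    produces a point [q] which [a] still moves by a bounded amount and with
    [2 * len q] equal to [len a] up to a constant ([coarse_fixed_points]): [q]
    is a coarse midpoint of a geodesic from [1] to [a], and [a] is a coarse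
    reflection, carrying the half from [1] to [q] onto the half from [a] to [q].

    Let [a] be a long element of [A]; by quasiconvexity some [y] in [A] is close
    to the point at three quarters of the way from [1] to [a]. For every [g],
    one of [g] and [g * y], call it [g'], has the property that the conjugate
    [g' * a * g'^-1] has length [2 * len g] up to a constant
    ([displacement_ge], [halfspaces_disjoint]). Hence [g] lies coarsely between
    [1] and an element of [A] ([conj_extension]), and quasiconvexity puts it
    close to [A]: the set [A] is coarsely dense ([coarsely_dense]).

    Consequently, for every geodesic [p] from [1] to [g] and every [m], there
    is a group element carrying [p s] close to [p (m - s)] for [2 * s <= m]
    ([coarse_reflection]). Composing those for [m = len g] and
    [m = len g - l] gives an element [h] which moves [p s] close to
    [p (s + l)] for all [s] up to about half of [len g], with an error that
    does not depend on [l] ([coarse_translation]). For [l] a large constant,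
    there are finitely many such [h], and [h ^+ i] follows [p (i * l)] with an
    error that is a small fraction of [i * l] ([coarse_axis]). So some [h] has
    infinite order ([infinite_order]); moreover, as every [g] is coarsely on
    the way to an element about four times as long, [g] is determined up to
    a bounded error by [len g] and [h] ([sphere_code]), that is, the spheres of
    [G] have bounded size. Counting the products of powers of [h] with coset
    representatives, the subgroup generated by [h] has finite index
    ([bounded_spheres_finite_index]).

    Quasiconvexity refers to another generating set [S]. It is only used to
    find points of [A] close to geodesics of [T] with endpoints in [A], and for
    this it suffices that geodesics of a hyperbolic metric stay close to
    quasi-geodesics, here the geodesics of [S]
    ([geodesic_near_quasigeodesic]). All the geometry is done with
    integer-valued distances and the four-point inequality. *)

Set Implicit Arguments.
Unset Strict Implicit.
Unset Printing Implicit Defensive.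

Local Open Scope classical_set_scope.

(** * Word metrics *)

Section WordMetric.
Context (G : groupType) (S : generating_set G).
Implicit Types (g h x y z : G) (w : seq G).

(** The word [w] in the generators represents [g]. *)
Definition spells w g : Prop :=
  {in w, forall s, gens S s} /\ g = (\prod_(s <- w) s)%g.

Lemma spells_nil : spells [::] 1%g.
Proof. by split=> //; rewrite big_nil. Qed.

Lemma spells_cat v w g h :
  spells v g -> spells w h -> spells (v ++ w) (g * h)%g.
Proof.
move=> [Sv ->] [Sw ->]; split; last by rewrite big_cat.
by move=> s; rewrite mem_cat => /orP[/Sv|/Sw].
Qed.

Lemma spells1 s : gens S s -> spells [:: s] s.
Proof.
by move=> Ss; split=> [t|]; rewrite ?big_seq1// inE => /eqP ->.
Qed.

Lemma spells_inv w g : spells w g ->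
  exists2 v, size v = size w & spells v (g^-1)%g.
Proof.
elim: w g => [|s w IH] g [Sw ->].
  by exists [::] => //; rewrite big_nil invg1; exact: spells_nil.
have [|v vw Sv] := IH (\prod_(s <- w) s)%g.
  by split=> // t tw; apply: Sw; rewrite inE tw orbT.
exists (v ++ [:: (s^-1)%g]); first by rewrite size_cat vw addn1.
rewrite big_cons invgM; apply: spells_cat Sv (spells1 _).
by apply: gens_sym; apply: Sw; rewrite inE eqxx.
Qed.

Lemma word_size_exists g : exists n, `[< exists2 w, size w = n & spells w g >].
Proof.
have [w Sw gE] := gens_generate S g.
by exists (size w); apply/asboolP; exists w.
Qed.

(** The word length of [g] with respect to [S]. *)
Definition wlen g : nat := ex_minn (word_size_exists g).

Lemma wlen_word g : exists2 w, size w = wlen g & spells w g.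
Proof. by rewrite /wlen; case: ex_minnP => n /asboolP. Qed.

Lemma wlen_le w g : spells w g -> wlen g <= size w.
Proof.
move=> Sw; rewrite /wlen; case: ex_minnP => n _; apply.
by apply/asboolP; exists w.
Qed.

Lemma wlen1 : wlen 1%g = 0.
Proof. by apply/eqP; rewrite -leqn0 (wlen_le spells_nil). Qed.

Lemma wlen0 g : wlen g = 0 -> g = 1%g.
Proof.
move=> g0; have [w] := wlen_word g.
by rewrite g0 => /size0nil -> [_]; rewrite big_nil.
Qed.

Lemma wlen_gens s : gens S s -> wlen s <= 1.
Proof. by move=> /spells1/wlen_le. Qed.

Lemma wlenM g h : wlen (g * h)%g <= wlen g + wlen h.
Proof.
have [v <- Sv] := wlen_word g; have [w <- Sw] := wlen_word h.
by rewrite -size_cat; apply/wlen_le/spells_cat.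
Qed.

Lemma wlenV_le g : wlen (g^-1)%g <= wlen g.
Proof. by have [w <- /spells_inv[v <- /wlen_le]] := wlen_word g. Qed.

Lemma wlenV g : wlen (g^-1)%g = wlen g.
Proof. by apply/eqP; rewrite eqn_leq wlenV_le -{1}(invgK g) wlenV_le. Qed.

Lemma finite_wball n : finite_set [set g | wlen g <= n].
Proof.
have fS := gens_finite S; elim: n => [|n IH].
  apply: sub_finite_set (finite_set1 1%g) => g /=.
  by rewrite leqn0 => /eqP/wlen0.
apply: sub_finite_set (_ : finite_set
  ([set 1%g] `|` [set (p.1 * p.2)%g | p in gens S `*` [set g | wlen g <= n]])).
  move=> g /= gn; have [[|s w] /= sw [Sw gE]] := wlen_word g.
    by left; rewrite gE big_nil.
  right; exists (s, \prod_(s <- w) s)%g; last by rewrite gE big_cons.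
  split=> /=; first by apply: Sw; rewrite inE eqxx.
  rewrite -ltnS (leq_trans _ gn)// -sw ltnS; apply: wlen_le; split=> // t tw.
  by apply: Sw; rewrite inE tw orbT.
rewrite finite_setU; split; first exact: finite_set1.
exact/finite_image/finite_setX.
Qed.

Lemma finite_wballP n : exists B : seq G, forall g, wlen g <= n -> g \in B.
Proof.
have /finite_seqP[B BE] := finite_wball n; exists B => g gn.
by have : [set g | wlen g <= n] g by []; rewrite BE.
Qed.

Lemma infinite_wlen (A : set G) n :
  infinite_set A -> exists2 a, A a & n < wlen a.
Proof.
move=> iA; apply: contrapT => nA; apply: iA.
apply: sub_finite_set (finite_wball n) => a Aa /=.
by rewrite leqNgt; apply/negP => an; apply: nA; exists a.
Qed.

(** The left-invariant word metric. *)
Definition wdist x y : nat := wlen (x^-1 * y)%g.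

Lemma wdistxx x : wdist x x = 0.
Proof. by rewrite /wdist mulVg wlen1. Qed.

Lemma wdistC x y : wdist x y = wdist y x.
Proof. by rewrite /wdist -wlenV invgM invgK. Qed.

Lemma wdist_triangle y x z : wdist x z <= wdist x y + wdist y z.
Proof.
rewrite /wdist; have -> : (x^-1 * z = (x^-1 * y) * (y^-1 * z))%g.
  by rewrite -mulgA mulVKg.
exact: wlenM.
Qed.

Lemma wdistM g x y : wdist (g * x)%g (g * y)%g = wdist x y.
Proof. by rewrite /wdist invgM -mulgA mulKg. Qed.

Lemma wdist1 g : wdist 1%g g = wlen g.
Proof. by rewrite /wdist invg1 mul1g. Qed.

Lemma wdistMr x g : wdist x (x * g)%g = wlen g.
Proof. by rewrite /wdist mulKg. Qed.

(** A discrete geodesic from [x] to [y]; only the values of [p] up to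
    [wdist x y] matter. *)
Definition wgeodesic (p : nat -> G) x y : Prop :=
  [/\ p 0 = x, p (wdist x y) = y &
    forall i j, i <= j <= wdist x y -> wdist (p i) (p j) = j - i].

Lemma wgeodesic_exists x y :
  exists2 p, wgeodesic p x y &
    forall i, i < wdist x y -> gens S ((p i)^-1 * p i.+1)%g.
Proof.
have [w sw [Sw xyE]] := wlen_word (x^-1 * y)%g.
pose p i := (x * \prod_(s <- take i w) s)%g.
have p0 : p 0 = x by rewrite /p take0 big_nil mulg1.
have pn : p (wdist x y) = y.
  by rewrite /p /wdist -sw take_size -xyE mulVKg.
have pS i j : i <= j -> p j = (p i * \prod_(s <- take (j - i) (drop i w)) s)%g.
  by move=> ij; rewrite /p -mulgA -big_cat -takeD subnKC.
have pij i j : i <= j -> wdist (p i) (p j) <= j - i.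
  move=> ij; rewrite (pS i j)// wdistMr.
  have /wlen_le/leq_trans : spells (take (j - i) (drop i w))
      (\prod_(s <- take (j - i) (drop i w)) s)%g.
    by split=> // s /mem_take/mem_drop/Sw.
  by apply; rewrite size_take_min; lia.
exists p.
  split=> // i j /andP[ij jn].
  have d0n : wdist (p 0) (p (wdist x y)) = wdist x y by rewrite p0 pn.
  have := wdist_triangle (p i) (p 0) (p (wdist x y)).
  have := wdist_triangle (p j) (p i) (p (wdist x y)).
  by have := pij 0 i isT; have := pij i j ij; have := pij j _ jn; lia.
move=> i; rewrite /wdist -sw => iw; rewrite (pS i i.+1)// mulKg subSnn.
by rewrite (drop_nth 1%g)// take_cons take0 big_seq1; apply/Sw/mem_nth.
Qed.

Lemma wdist_split x y i : i <= wdist x y ->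
  exists2 z, wdist x z = i & wdist z y = wdist x y - i.
Proof.
move=> ixy; have [p [p0 pn pij] _] := wgeodesic_exists x y.
have := pij 0 i; have := pij i (wdist x y); rewrite p0 pn ixy leqnn subn0.
by move=> iy xi; exists (p i); [apply: xi|apply: iy].
Qed.

End WordMetric.

Lemma wlen_lipschitz (G : groupType) (S T : generating_set G) :
  exists c, forall g, wlen T g <= c * wlen S g.
Proof.
have /finite_seqP[B BE] := gens_finite S.
exists (\max_(s <- B) wlen T s) => g.
have [w <- [Sw ->]] := wlen_word S g; elim: w Sw {g} => [|s w IH] Sw.
  by rewrite big_nil wlen1.
rewrite big_cons mulnS; apply: leq_trans (wlenM _ _ _) (leq_add _ _).
  have : gens S s by apply: Sw; rewrite inE eqxx.
  by rewrite BE => sB; apply: (@leq_bigmax_seq _ B xpredT).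
by apply: IH => t tw; apply: Sw; rewrite inE tw orbT.
Qed.

(** * Geodesics stay close to quasi-geodesics *)

Lemma linear_le_exp c k :
  exists N, forall n, N < n -> c * n <= 2 ^ (n %/ k.+1).
Proof.
have b_exp b e : 3 * b <= e -> b * e.+1 <= 2 ^ e.
  elim: e => [|e IH]; first by case: b.
  rewrite leq_eqVlt => /orP[/eqP <-|/IH]; last by rewrite expnS; nia.
  have b1 : b < 2 ^ b by apply: ltn_expl.
  have b3 : b.+1 * (b.+1 * b.+1) <= 2 ^ (3 * b).
    by rewrite (_ : 3 * b = b + (b + b)); [rewrite !expnD !leq_mul|lia].
  by nia.
set b := c * k.+1; exists (3 * b * k.+1) => n bn.
apply: leq_trans (b_exp b (n %/ k.+1) _); last by rewrite leq_divRL// ltnW.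
by rewrite -mulnA leq_mul2l ltnW ?orbT// mulnC ltn_ceil.
Qed.

Section Hyperbolic.
Context (G : groupType) (T : generating_set G).
Local Notation d := (wdist T).

(** The four-point inequality: Gromov hyperbolicity with constant [delta / 2], cf.
    [gromov_hyperbolic], for the integer-valued metric of the group. *)
Definition four_point delta := forall x y z w,
  d x y + d z w <= maxn (d x z + d y w) (d x w + d y z) + delta.

Context (delta : nat) (hyp : four_point delta).

(** A path with steps of length at most [c] that stays out of the ball of radius
    [r] around [w] has endpoints whose Gromov product at [w] is at least [r], up
    to an error logarithmic in the number of steps: halve the path [e] times. *)
Lemma path_avoiding_ball (u : nat -> G) w n r c :
  (forall i, i <= n -> r <= d (u i) w) ->
  (forall i, i < n -> d (u i) (u i.+1) <= c) ->
  forall e i j, i <= j <= n -> j - i <= 2 ^ e ->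
  2 * r + d (u i) (u j) <= d (u i) w + d (u j) w + c + e * delta.
Proof.
move=> ur uc; elim=> [|e IH] i j ijn ije.
  have := ur i; have := ur j; have := uc i.
  have [jE|jE] : j = i \/ j = i.+1 by lia.
    by rewrite jE wdistxx in ijn *; lia.
  by rewrite jE in ijn *; lia.
have [m imj [im mj]] : exists2 m, i <= m <= j &
    m - i <= 2 ^ e /\ j - m <= 2 ^ e.
  by exists (i + (j - i) %/ 2); rewrite expnS in ije; lia.
have := IH i m _ im; have := IH m j _ mj; have := ur m.
have := hyp (u i) (u j) (u m) w.
by rewrite (wdistC T (u j) (u m)) mulSn; lia.
Qed.

(** The equation on [w] says that [w] lies on a geodesic with the same endpoints
    as the quasi-geodesic [v]. If [w] is a point of such a geodesic at maximal
    distance [r] from [v], take points [y] and [z] of the geodesic at distance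
    [2 * r] from [w] on both sides; they are joined by a path of length linear
    in [r] that runs along [v] and avoids the ball of radius [r] around [w],
    which bounds [r] by [path_avoiding_ball]. *)
Lemma geodesic_near_quasigeodesic c : exists r0, forall n (v : nat -> G),
  (forall i, i < n -> d (v i) (v i.+1) <= c) ->
  (forall i j, i <= j <= n -> j - i <= c * d (v i) (v j)) ->
  forall w, d (v 0) w + d w (v n) = d (v 0) (v n) ->
  exists2 i, i <= n & d w (v i) <= r0.
Proof.
have [N NE] := linear_le_exp (6 * c) delta.
exists (maxn N (c + 2 * delta)) => n v vc vq.
pose near r := forall w, d (v 0) w + d w (v n) = d (v 0) (v n) ->
  exists2 i, i <= n & d w (v i) <= r.
have ex_near : exists r, `[< near r >].
  exists (d (v 0) (v n)); apply/asboolP => w wb; exists 0 => //.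
  by rewrite wdistC; lia.
have [r /asboolP nr rmin] := ex_minnP ex_near.
suff rle : r <= maxn N (c + 2 * delta).
  by move=> w /nr[i ? ?]; exists i => //; lia.
rewrite leqNgt; apply/negP => rN.
(* [r] is minimal: some point [w] of a geodesic is at distance at least [r]
   from the whole path. *)
have [w wb wr] : exists2 w, d (v 0) w + d w (v n) = d (v 0) (v n) &
    forall i, i <= n -> r <= d (v i) w.
  apply: contrapT => nw; suff /asboolP/rmin : near r.-1 by lia.
  move=> w wb; apply: contrapT => ni; apply: nw; exists w => // i ile.
  rewrite leqNgt; apply/negP => ir; apply: ni.
  by exists i => //; rewrite wdistC; lia.
(* The point [y] between [v e] and [w] is at distance [2 * r] from [w], or is the
   endpoint [v e] itself if that is closer. The last inequality says that the
   Gromov product of [y] and [v i] at [w] is at least [r]. *)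
have side e : (e = 0 \/ e = n) -> exists y i, [/\ i <= n, d y w <= 2 * r,
    d y (v i) <= r, d (v e) y + d y w = d (v e) w &
    2 * r + d y (v i) <= d y w + d (v i) w].
  move=> e0n; have en : e <= n by lia.
  have [er|er] := leqP (d (v e) w) (2 * r).
    exists (v e), e; split=> //; rewrite wdistxx ?add0n//.
    by have := wr e; lia.
  have [|y ey yw] := @wdist_split _ T (v e) w (d (v e) w - 2 * r); first by lia.
  have [i ile iy] : exists2 i, i <= n & d y (v i) <= r.
    apply: nr; case: e0n => ee; subst e.
      have := wdist_triangle T y (v 0) (v n).
      by have := wdist_triangle T w y (v n); lia.
    have := wdist_triangle T y (v 0) (v n); have := wdist_triangle T w (v 0) y.
    rewrite (wdistC T y (v n)) (wdistC T w y) (wdistC T w (v n)) in wb *.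
    by lia.
  by exists y, i; split=> //; have := wr i; lia.
have [y [i [ile yw yi ye yg]]] := side 0 (or_introl erefl).
have [z [j [jle zw zj ze zg]]] := side n (or_intror erefl).
have vij : 2 * r + d (v i) (v j) <=
    d (v i) w + d (v j) w + c + r %/ delta.+1 * delta.
  have dij : d (v i) (v j) <= 6 * r.
    have := wdist_triangle T y (v i) (v j); have := wdist_triangle T w y (v j).
    have := wdist_triangle T z w (v j).
    by rewrite (wdistC T (v i) y) (wdistC T w z); lia.
  have c6 : c * d (v i) (v j) <= 2 ^ (r %/ delta.+1).
    by apply: leq_trans (NE r _); [rewrite mulnAC [c * _]mulnC leq_mul|lia].
  case: (leqP i j) => ij.
    by apply: (path_avoiding_ball wr vc); [lia|have := vq i j; lia].
  rewrite wdistC (addnC (d (v i) w)).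
  apply: (path_avoiding_ball wr vc); first by lia.
  by have := vq j i; rewrite wdistC; lia.
have yz : d y w + d z w <= d y z.
  have := wdist_triangle T y (v 0) (v n); have := wdist_triangle T z y (v n).
  by move: wb; rewrite (wdistC T w (v n)) (wdistC T z (v n)); lia.
have eg : r %/ delta.+1 * delta <= r.
  by apply: leq_trans (leq_divM r delta.+1); rewrite leq_mul.
have := hyp y z (v i) w; have := hyp (v i) z (v j) w.
rewrite (wdistC T z (v i)) (wdistC T z (v j)) in zg *.
have := wr i ile; have := wr j jle.
by lia.
Qed.

End Hyperbolic.

(** * Coarse reflections along a conjugation-invariant quasiconvex set *)

Section CoarseReflections.
Context (G : groupType) (T : generating_set G) (delta : nat).
Context (hyp : four_point T delta) (A : set G).
Local Notation d := (wdist T).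
Local Notation len := (wlen T).

(** If [a] moves some point [k] by at most [m], then it also moves by a bounded
    amount some point [q] whose distance to [1] is at most half the length of
    [a], up to a constant. *)
Lemma coarse_fixed_point m a k : d k (a * k)%g <= m ->
  exists2 q, d q (a * q)%g <= 2 * m + 2 * delta + 2
           & 2 * len q <= len a + 2 * m + 2 * delta + 2.
Proof.
move=> kak.
(* The geodesics from [k] to [1] and from [a * k] to [a] fellow-travel for a
   length [rho], the Gromov product of [1] and [a] at [k]; the truncated
   subtraction gives [0] when [len a] exceeds [2 * len k]. *)
set rho := (2 * d 1%g k - d 1%g a) %/ 2.
have [|q oq qk] := @wdist_split _ T 1%g k (d 1%g k - rho); first by lia.
have aq : d a (a * q)%g = d 1%g q by rewrite -{1}(mulg1 a) wdistM.
have ak : d a (a * k)%g = d 1%g k by rewrite -{1}(mulg1 a) wdistM.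
have aqk : d (a * q)%g (a * k)%g = d q k by rewrite wdistM.
have := wdist_triangle T k 1%g a; have := wdist_triangle T (a * k)%g k a.
have := hyp q a 1%g k; have := hyp q (a * q)%g a (a * k)%g.
have := wdist_triangle T k q (a * k)%g.
have := wdistC T q 1%g; have := wdistC T a k; have := wdistC T a 1%g.
have := wdistC T (a * k)%g a; have := wdistC T (a * q)%g a.
by exists q; rewrite -?(wdist1 T); lia.
Qed.

(** Let [q] be a coarse midpoint of [1] and [a] moved little by [a]. If geodesics
    from [1] to [x] and from [1] to [a] separate well before [q], then so do
    those from [a] to [a * x] and from [a] to [1]; hence every geodesic from [x]
    to [a * x] passes close to [q]. *)
Lemma displacement_ge m a q x : d q (a * q)%g <= m -> 2 * len q <= len a + m ->
  len x + 3 * m + delta < d x a -> 2 * len x <= d x (a * x)%g + 2 * len q.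
Proof.
move=> qaq qa xa; rewrite -!(wdist1 T) in qa xa *.
have aq : d a (a * q)%g = d 1%g q by rewrite -{1}(mulg1 a) wdistM.
have ax : d a (a * x)%g = d 1%g x by rewrite -{1}(mulg1 a) wdistM.
have axq : d (a * x)%g (a * q)%g = d x q by rewrite wdistM.
have := hyp 1%g a x q; have := hyp a x (a * x)%g q.
have := wdist_triangle T q x a; have := wdist_triangle T (a * q)%g q a.
have := wdist_triangle T q (a * x)%g (a * q)%g.
have := wdistC T q a; have := wdistC T a x; have := wdistC T (a * q)%g a.
have := wdist_triangle T q 1%g x; have := wdistC T x q.
have := wdistC T (a * x)%g q.
have := wdistC T (a * x)%g x.
by lia.
Qed.

(** The points [x] with [d x a <= len x + c] form a coarse half-space, beyond the
    midpoint of [1] and [a]. If [y] is close to the point [p] at three quarters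
    of the way from [1] to [a] and acts as a coarse reflection in a midpoint [q]
    of [1] and [y], then this half-space is disjoint from its translate by [y]:
    [y] carries the way from [1] to [q] onto the way from [y] back to [q], so
    the geodesic from [y] to [y * a] runs past [q] before its midpoint, while
    [q] comes before the midpoint of [1] and [a]. *)
Lemma halfspaces_disjoint m e c a p y q x :
  d 1%g p = len a - len a %/ 4 -> d p a = len a %/ 4 -> d p y <= e ->
  d q (y * q)%g <= m -> 2 * len q <= len y + m ->
  16 * (c + m + e + delta).+1 <= len a ->
  d x a <= len x + c -> len (y^-1 * x)%g + c < d (y^-1 * x)%g a.
Proof.
move=> op pa py qyq qy ca xa; rewrite -!(wdist1 T) in op pa qy ca xa *.
rewrite -(wdistM T y 1%g) -(wdistM T y _ a) mulVKg mulg1.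
have yq : d y (y * q)%g = d 1%g q by rewrite -{1}(mulg1 y) wdistM.
have ya : d y (y * a)%g = d 1%g a by rewrite -{1}(mulg1 y) wdistM.
have yaq : d (y * q)%g (y * a)%g = d q a by rewrite wdistM.
have := hyp x p 1%g a; have := hyp y (y * a)%g x q.
have := wdist_triangle T p x y; have := wdist_triangle T p 1%g y.
have := wdist_triangle T (y * q)%g q (y * a)%g.
have := wdist_triangle T y q a; have := wdist_triangle T p y a.
have := wdist_triangle T (y * q)%g q y.
have := wdist_triangle T q 1%g x.
have := wdistC T x 1%g; have := wdistC T x y; have := wdistC T x q.
have := wdistC T (y * q)%g y; have := wdistC T q (y * a)%g.
have := wdistC T y p; have := wdistC T x (y * a)%g; have := wdistC T p 1%g.
have := wdistC T y q; have := wdistC T y x.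
by rewrite ltnNge; lia.
Qed.

(** The hypotheses on [A] used below: invariance under conjugation, bounded
    displacement of some point by each element of [A], quasiconvexity for
    geodesics of [T], and infiniteness. *)
Context (conjA : forall a g, A a -> A (a ^ g)%g).
Context (fixA : exists m, forall a, A a -> exists k, d k (a * k)%g <= m).
Context (qcA : exists e, forall a b w, A a -> A b ->
  d a w + d w b = d a b -> exists2 c, A c & d w c <= e).
Context (infA : infinite_set A).

Lemma coarse_fixed_points : exists m, forall a, A a ->
  exists2 q, d q (a * q)%g <= m & 2 * len q <= len a + m.
Proof.
have [m mA] := fixA; exists (2 * m + 2 * delta + 2) => a /mA[k].
by move=> /coarse_fixed_point[q qa ql]; exists q => //; lia.
Qed.

Lemma coarsely_between_near k : exists e, forall a b w, A a -> A b ->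
  d a w + d w b <= d a b + k -> exists2 c, A c & d w c <= e.
Proof.
have [e eA] := qcA; exists (k + delta + e) => a b w Aa Ab awb.
have [|v av vb] := @wdist_split _ T a b (minn (d a w) (d a b)); first by lia.
have [|c Ac vc] := eA a b v Aa Ab; first by lia.
exists c => //; have := wdist_triangle T v w c; have := hyp w v a b.
have := wdist_triangle T w a b; have := wdistC T w a; have := wdistC T v b.
by have := wdistC T v a; have := wdistC T w v; lia.
Qed.

(** The base point [1] need not belong to [A], but it may replace one endpoint in
    [coarsely_between_near]: for a fixed [b] in [A], a point coarsely between
    [1] and [a] is coarsely between [b] and [a] or close to [b]. *)
Lemma coarsely_between1_near k : exists e, forall a w, A a ->
  len w + d w a <= len a + k -> exists2 c, A c & d w c <= e.
Proof.
have [b Ab] := infinite_setN0 infA.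
have [e eA] := coarsely_between_near (len b + len b + k + delta).
exists (len b + k + delta + e) => a w Aa; rewrite -!(wdist1 T) => wa.
have := hyp w b 1%g a; have := wdistC T w 1%g; have := wdistC T b 1%g.
have := wdist_triangle T 1%g w a; have := wdistC T w b; have := wdistC T b a.
rewrite -(wdist1 T) in eA *.
have [bw|bw] := leqP (d w b) (d 1%g b + k + delta).
  by exists b => //; lia.
move=> *; have [//|//||c Ac wc] := eA b a w; first by lia.
by exists c => //; lia.
Qed.

(** Every [g] lies coarsely halfway between [1] and an element of [A]. *)
Lemma conj_extension : exists k, forall g, exists2 b, A b &
  2 * len g <= len b + k /\ d g b <= len g + k.
Proof.
have [m mA] := coarse_fixed_points.
have [e eA] := coarsely_between1_near 0.
set c := 3 * m + delta.
have [a Aa la] := infinite_wlen T (16 * (c + m + e + delta).+1) infA.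
have [q aq ql] := mA a Aa.
have [|p op pa] := @wdist_split _ T 1%g a (len a - len a %/ 4).
  by rewrite wdist1; lia.
rewrite wdist1 in pa.
have [|y Ay py] := eA a p Aa; first by rewrite -(wdist1 T p); lia.
have [q' yq' ql'] := mA y Ay.
have lenJ g : len (a ^ (g^-1))%g = d (g^-1)%g (a * g^-1)%g.
  by rewrite /conjg /wdist.
have dJ g : d g (a ^ (g^-1))%g <= len a + len g.
  rewrite /conjg /wdist invgK mulKg.
  by apply: leq_trans (wlenM _ _ _) _; rewrite wlenV.
exists (2 * len q + len a + 4 * len y) => g.
have [ga|ga] := leqP (d (g^-1)%g a) (len (g^-1)%g + c).
  have := halfspaces_disjoint op _ py yq' ql' (ltnW la) ga.
  have -> : d p a = len a %/ 4 by lia.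
  move=> /(_ erefl); rewrite -invgM /c addnA => /(displacement_ge aq ql) gya.
  have {}gya : 2 * len (g * y)%g <= len (a ^ ((g * y)^-1))%g + 2 * len q.
    by rewrite lenJ -(wlenV T (g * y)%g).
  exists (a ^ ((g * y)^-1))%g; first exact: conjA.
  have := dJ (g * y)%g; have := wlenM T g y; have := wlenM T (g * y)%g (y^-1)%g.
  rewrite mulgK wlenV.
  have := wdist_triangle T (g * y)%g g (a ^ ((g * y)^-1))%g.
  by have := wdistMr T g y; lia.
move: ga; rewrite /c addnA => /(displacement_ge aq ql).
rewrite -lenJ wlenV => ga.
exists (a ^ (g^-1))%g; first exact: conjA.
by have := dJ g; lia.
Qed.

Lemma coarsely_dense : exists k, forall g, exists2 c, A c & d g c <= k.
Proof.
have [k kA] := conj_extension; have [e eA] := coarsely_between1_near (2 * k).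
by exists e => g; have [b Ab [gb bg]] := kA g; apply: eA Ab _; lia.
Qed.

(** Here [u] and [v] are points on geodesics from [1] to [g], at the same distance
    from [1] and from [g] respectively, with [u] in the first half. *)
Lemma coarse_reflection : exists k, forall g, exists2 c, d g c <= k &
  forall u v, len u + d u g = len g -> len v + d v g = len g ->
  len u + len v = len g -> len u <= len v -> d (c * u)%g v <= k.
Proof.
have [k kA] := coarsely_dense; have [m mA] := coarse_fixed_points.
exists (10 * (k + m + delta)) => g.
have [c Ac gc] := kA g; have [q cq ql] := mA c Ac.
exists c => [|u v]; first by lia.
rewrite -!(wdist1 T) in ql * => ug vg uv luv.
have co : d c (c * q)%g = d 1%g q by rewrite -{1}(mulg1 c) wdistM.
have cu : d c (c * u)%g = d 1%g u by rewrite -{1}(mulg1 c) wdistM.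
have cuq : d (c * u)%g (c * q)%g = d u q by rewrite wdistM.
have := wdist_triangle T g 1%g c; have := wdist_triangle T c 1%g g.
have := wdist_triangle T q 1%g c; have := wdist_triangle T (c * q)%g q c.
have := wdist_triangle T c q g; have := wdist_triangle T q 1%g g.
have := hyp u q 1%g g; have := hyp v q 1%g g.
have := hyp (c * u)%g v q g.
have := wdist_triangle T (c * q)%g (c * u)%g q.
have := wdist_triangle T c (c * u)%g g.
have := wdistC T q 1%g; have := wdistC T u 1%g; have := wdistC T v 1%g.
have := wdistC T (c * q)%g q; have := wdistC T (c * q)%g c.
have := wdistC T (c * u)%g c; have := wdistC T c g.
have := wdistC T v q.
by lia.
Qed.

Lemma wgeodesic_len p g i : wgeodesic T p 1%g g -> i <= len g -> len (p i) = i.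
Proof.
rewrite -!(wdist1 T) => -[p0 _ /(_ 0 i)]; rewrite p0 subn0 leq0n /= => pi ig.
exact: pi.
Qed.

(** The product of two coarse reflections along [p] is a coarse translation. The
    error [k] does not depend on the translation length [l]. *)
Lemma coarse_translation : exists k, forall l g p, wgeodesic T p 1%g g ->
  exists h, forall s, 2 * s + 2 * l <= len g -> d (h * p s)%g (p (s + l)) <= k.
Proof.
have [k kA] := coarse_reflection; exists (2 * k) => l g p pg.
have pl i : i <= len g -> len (p i) = i by apply: wgeodesic_len pg.
have pij i j : i <= j <= len g -> d (p i) (p j) = j - i.
  by have [_ _] := pg; rewrite wdist1; apply.
have [b _ bp] := kA (p (len g)); have [c _ cp] := kA (p (len g - l)).
(* Both [c * p s] and [b * p (s + l)] are close to [p (len g - l - s)]. *)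
exists (b^-1 * c)%g => s sl.
have {}bp : d (b * p (s + l))%g (p (len g - l - s)) <= k.
  by apply: bp; rewrite ?pij ?pl; lia.
have {}cp : d (c * p s)%g (p (len g - l - s)) <= k.
  by apply: cp; rewrite ?pij ?pl; lia.
have -> : d (b^-1 * c * p s)%g (p (s + l)) = d (c * p s)%g (b * p (s + l))%g.
  by rewrite -(wdistM T b) -(mulgA _ c) mulVKg.
have := wdist_triangle T (p (len g - l - s)) (c * p s)%g (b * p (s + l))%g.
by have := wdistC T (b * p (s + l))%g (p (len g - l - s)); lia.
Qed.

(** The errors of [coarse_translation] add up along the powers of [h], but a
    translation length [l] above four times the error keeps the total below a
    quarter of the distance covered. *)
Lemma coarse_axis : exists2 l, 0 < l & forall g p, wgeodesic T p 1%g g ->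
  exists2 h, len h <= 2 * l & forall i, 2 * (i * l) <= len g ->
    4 * d (h ^+ i)%g (p (i * l)) <= i * l.
Proof.
have [k kA] := coarse_translation.
have [l lE] : exists l, l = 4 * k + 4 by exists (4 * k + 4).
exists l => [|g p pg]; first by lia.
have p0 : p 0 = 1%g by have [] := pg.
have [gl|lg] := ltnP (len g) (2 * l).
  exists 1%g => [|i]; first by rewrite wlen1.
  by case: i => [|i]; [rewrite mul0n p0 wdistxx|rewrite mulSn; lia].
have [h hp] := kA l g p pg.
have hi i : 2 * (i * l) <= len g -> d (h ^+ i)%g (p (i * l)) <= i * k.
  elim: i => [|i IH] il; first by rewrite mul0n p0 wdistxx.
  have iSl : i.+1 * l = i * l + l by rewrite mulSn addnC.
  have -> : (h ^+ i.+1 = h * h ^+ i)%g by rewrite expgS.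
  rewrite iSl in il *; rewrite mulSn.
  have := IH _; have := hp (i * l).
  have := wdist_triangle T (h * p (i * l)%N)%g (h * h ^+ i)%g (p (i * l + l)).
  by rewrite wdistM; lia.
exists h => [|i il].
  have := hi 1; rewrite !mul1n expg1 => /(_ lg).
  have := wdist_triangle T (p l) 1%g h; rewrite !wdist1 (wdistC T (p l)).
  by rewrite (wgeodesic_len pg); lia.
by apply: leq_trans (leq_mul (leqnn 4) (hi i il)) _; rewrite lE; nia.
Qed.

Lemma infinite_order : exists b, forall n, exists2 h, len h <= b &
  forall i, 0 < i <= n -> (h ^+ i)%g != 1%g.
Proof.
have [l l0 lA] := coarse_axis; exists (2 * l) => n.
have [g _ gn] := infinite_wlen T (2 * (n * l)) infA.
have [p pg _] := wgeodesic_exists T 1%g g.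
have [h hl hp] := lA g p pg; exists h => // i /andP[i0 ni]; apply/eqP => hi.
have il : i * l <= n * l by rewrite leq_mul2r ni orbT.
have := hp i; rewrite hi wdist1 (wgeodesic_len pg); last by lia.
have : 0 < i * l by rewrite muln_gt0 i0 l0.
by lia.
Qed.

(** An element [g] is determined, up to a bounded error, by its length and by an
    element [h] of a fixed ball; in particular spheres have bounded size. *)
Lemma sphere_code : exists b e (z : nat -> G -> G), forall g,
  exists2 h, len h <= b & d g (z (len g) h) <= e.
Proof.
have [l l0 lA] := coarse_axis; have [k kA] := conj_extension.
have /choice[geo geoP] : forall x, exists p, wgeodesic T p 1%g x.
  by move=> x; have [p ? _] := wgeodesic_exists T 1%g x; exists p.
(* Two applications of [conj_extension] give an element [b2] with
   [4 * len g <= len b2 + 3 * k], so the powers of [h] are controlled up to the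
   exponent [ex (len g)]. The corresponding power [y] is close to a point [x] at
   distance about [2 * len g] on the way from [1] to [b2], and its error, at most
   a quarter of that distance, is small enough for [g] to be close to the point
   [z] at distance [len g] from [1] on a geodesic from [1] to [y]. *)
pose ex r := (4 * r - 3 * k) %/ (2 * l).
exists (2 * l), (20 * (k + l + delta)),
  (fun r h => geo (h ^+ ex r)%g (minn r (len (h ^+ ex r)%g))) => g.
have [b1 _ [gb1 b1g]] := kA g; have [b2 _ [b12 b21]] := kA b1.
have [p pb _] := wgeodesic_exists T 1%g b2; have [h hl hp] := lA b2 p pb.
exists h => //.
set i := ex _; set y := (h ^+ i)%g; set z := geo y _.
have iE : 4 * len g - 3 * k <= 2 * (i * l) + 2 * l /\
          2 * (i * l) <= 4 * len g - 3 * k.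
  have := leq_divM (4 * len g - 3 * k) (2 * l).
  have := @ltn_ceil (4 * len g - 3 * k) (2 * l).
  by rewrite -/(ex (len g)) -/i; nia.
have ib : 2 * (i * l) <= len b2 by lia.
have yx := hp i ib; have xl := @wgeodesic_len p b2 (i * l) pb.
have xb : d (p (i * l)) b2 = len b2 - i * l.
  have [_ pn /(_ (i * l) (len b2))] := pb.
  by move: pn; rewrite wdist1 => -> ->//; rewrite leqnn andbT; lia.
have zl : len z = minn (len g) (len y) by apply: wgeodesic_len (geoP y) _; lia.
have zy : d z y = len y - len z.
  have [_ zn /(_ (minn (len g) (len y)) (len y))] := geoP y.
  by move: zn; rewrite -/z zl wdist1 => -> ->//; rewrite leqnn andbT; lia.
move: (i * l) (p (i * l)) yx xl xb ib iE => n x; rewrite -/y => yx xl xb ib iE.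
have := hyp g x 1%g b2; have := hyp g y 1%g x; have := hyp g z 1%g y.
have := wdist_triangle T b1 g b2; have := wdist_triangle T y x z.
rewrite !(wdistC T _ 1%g) !wdist1.
have := wdistC T y x; have := wdistC T y z.
by lia.
Qed.

End CoarseReflections.

(** * Bounded spheres and subgroups of finite index *)

Section Growth.
Context (G : groupType) (T : generating_set G).
Local Notation len := (wlen T).

Lemma cyclic_subgroup_exp (c : G) m n : cyclic_subgroup c (c ^+ m * c ^- n)%g.
Proof.
have [nm|mn] := leqP n m; [exists (m - n); left|exists (n - m); right].
  by rewrite expgnFr.
by rewrite expgnFr 1?ltnW// invgF.
Qed.

Lemma cyclic_subgroupM (c x : G) m n :
  cyclic_subgroup c x -> cyclic_subgroup c (c ^+ m * c ^- n * x)%g.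
Proof.
case=> i [->|->].
  have com : (c ^- n * c ^+ i = c ^+ i * c ^- n)%g.
    exact: commute_sym (commuteV (commuteX2 _ _ (commute_refl c))).
  have -> : (c ^+ m * c ^- n * c ^+ i = c ^+ (m + i) * c ^- n)%g.
    by rewrite expgnDr -!mulgA com.
  exact: cyclic_subgroup_exp.
have -> : (c ^+ m * c ^- n * c ^- i = c ^+ m * c ^- (i + n))%g.
  by rewrite expgnDr invgM mulgA.
exact: cyclic_subgroup_exp.
Qed.

Lemma cyclic_coset_eq (c g h : G) m n : (g * c ^+ m = h * c ^+ n)%g ->
  [set (g * x)%g | x in cyclic_subgroup c] =
  [set (h * x)%g | x in cyclic_subgroup c].
Proof.
have sub g1 g2 m1 m2 : (g1 * c ^+ m1 = g2 * c ^+ m2)%g ->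
    [set (g1 * x)%g | x in cyclic_subgroup c] `<=`
    [set (g2 * x)%g | x in cyclic_subgroup c].
  move=> g12 _ [x cx <-]; exists (c ^+ m2 * c ^- m1 * x)%g.
    exact: cyclic_subgroupM.
  by rewrite !mulgA -g12 mulgK.
by move=> gh; apply/seteqP; split; apply: sub; [exact: gh|exact: esym gh].
Qed.

Lemma wlen_expg (h : G) n : len (h ^+ n)%g <= n * len h.
Proof.
elim: n => [|n IH]; first by rewrite wlen1.
have -> : (h ^+ n.+1 = h * h ^+ n)%g by rewrite expgS.
by have := wlenM T h (h ^+ n)%g; rewrite mulSn; lia.
Qed.

(** If each element is determined, up to an error [e], by its length and by an
    element of a fixed ball, and if [h] has infinite order, then [h] generates a
    subgroup of finite index: with too many cosets [r j], the products
    [r j * h ^+ s] would be more numerous than the elements of the ball that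
    contains them. *)
Lemma bounded_spheres_finite_index (b e : nat) (z : nat -> G -> G) (h : G) :
  (forall g, exists2 x, len x <= b & wdist T g (z (len g) x) <= e) ->
  (forall i, 0 < i -> (h ^+ i)%g != 1%g) ->
  finite_index (cyclic_subgroup h).
Proof.
move=> zP h_oo; apply: contrapT => fin.
have [B1 B1P] := finite_wballP T b; have [B2 B2P] := finite_wballP T e.
have /choice[eta etaP] : forall g, exists x,
    len x <= b /\ wdist T g (z (len g) x) <= e.
  by move=> g; have [x] := zP g; exists x.
pose u g := ((z (len g) (eta g))^-1 * g)%g.
have uK g : (z (len g) (eta g) * u g = g)%g by rewrite mulVKg.
have eta1 g : eta g \in B1 by apply: B1P; have [] := etaP g.
have u2 g : u g \in B2 by apply: B2P; have [_] := etaP g; rewrite wdistC.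
pose c := (size B1).+1 * (size B2).+1; pose N := c * len h + 1.
have [Bs sB NB] := infinite_set_fset N fin.
have /choice[r rP] : forall j, exists g, j < N ->
    [set (g * x)%g | x in cyclic_subgroup h] = nth set0 Bs j.
  move=> j; have [jN|] := ltnP j N; last by exists 1%g.
  have [g _ gE] : range (fun g : G => [set (g * x)%g | x in cyclic_subgroup h])
      (nth set0 Bs j) by apply: sB; apply: mem_nth; apply: leq_trans NB.
  by exists g.
pose L := \max_(j < N) len (r j); pose n := c * L.+1.
pose M := n * len h + L.
pose x (js : 'I_N * 'I_n.+1) := (r js.1 * h ^+ js.2)%g.
have xM js : len (x js) <= M.
  apply: leq_trans (wlenM _ _ _) _; rewrite /M addnC leq_add//.
    apply: leq_trans (wlen_expg _ _) _; rewrite leq_mul2r.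
    by rewrite -ltnS ltn_ord orbT.
  exact: (@leq_bigmax _ (fun j : 'I_N => len (r j))).
have x_inj : injective x.
  move=> [j s] [k t]; rewrite /x /= => jk.
  have jkE : j = k.
    apply/val_inj/eqP; rewrite -(@nth_uniq _ set0 Bs) ?fset_uniq//.
    - by rewrite -(rP j)// -(rP k)//; apply/eqP; exact: cyclic_coset_eq jk.
    - exact: leq_trans (ltn_ord j) NB.
    - exact: leq_trans (ltn_ord k) NB.
  subst k; congr pair; move/mulgI: jk => st.
  wlog ts : s t st / t <= s.
    by move=> H; have [/(H _ _ (esym st))//|/ltnW/(H _ _ st)] := leqP s t.
  apply/val_inj/eqP; rewrite eqn_leq ts andbT leqNgt; apply/negP => ts'.
  have /h_oo/eqP[] : 0 < s - t by rewrite subn_gt0.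
  by rewrite expgnFr// st mulgV.
pose f js : 'I_M.+1 * ('I_(size B1).+1 * 'I_(size B2).+1) :=
  (inord (len (x js)),
    (inord (index (eta (x js)) B1), inord (index (u (x js)) B2))).
have f_inj : injective f.
  move=> js kt fE; apply: x_inj.
  have lE : len (x js) = len (x kt).
    by have := congr1 (fun p => val p.1) fE; rewrite /= !inordK ?ltnS ?xM.
  have eE : index (eta (x js)) B1 = index (eta (x kt)) B1.
    have := congr1 (fun p => val p.2.1) fE.
    by rewrite /= !inordK ?ltnS ?index_size.
  have uE : index (u (x js)) B2 = index (u (x kt)) B2.
    have := congr1 (fun p => val p.2.2) fE.
    by rewrite /= !inordK ?ltnS ?index_size.
  rewrite -(uK (x js)) -(uK (x kt)) lE.
  rewrite (index_inj 1%g (eta1 _) (eta1 _) eE).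
  by rewrite (index_inj 1%g (u2 _) (u2 _) uE).
(* The number of pairs exceeds the number of codes: [N] is chosen above
   [c * len h], and then [n] large compared with [c * L]. *)
have count c' n' L' lh : n' = c' * L'.+1 ->
  (c' * lh + 1) * n'.+1 <= (n' * lh + L').+1 * c' -> False by nia.
by have := leq_card f f_inj; rewrite !card_prod !card_ord; apply: count.
Qed.

End Growth.

(** * The word metric inside the Cayley graph *)

Section CayleyDistance.
Import Order.TTheory GRing.Theory Num.Theory.
Local Open Scope ring_scope.
Context (R : realType) (G : groupType) (S : generating_set G).
Local Notation d := (wdist S).

(** A weight [w] on the vertices with finite support extends affinely to the edges
    as the linear form [\sum_(k <- B) x k * w k] in the barycentric coordinates. *)
Lemma sum_edge_point (B : seq G) (w : G -> R) a b s :
  uniq B -> (forall k, k \notin B -> w k = 0) ->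
  \sum_(k <- B) edge_point a b s k * w k = (1 - s) * w a + s * w b.
Proof.
move=> uB wB.
have delta c : \sum_(k <- B) (k == c)%:R * w k = w c.
  have [cB|cB] := boolP (c \in B).
    rewrite (bigD1_seq c)//= eqxx mul1r big1 ?addr0// => k /negPf ->.
    by rewrite mul0r.
  rewrite wB// big_seq big1// => k kB.
  by have [kc|] := eqVneq k c; rewrite ?mul0r//; rewrite -kc kB in cB.
under eq_bigr do rewrite /edge_point mulrDl -!mulrA.
by rewrite big_split/= -!mulr_sumr !delta.
Qed.

Lemma edge_path_lipschitz (B : seq G) (w : G -> R) x y l :
  uniq B -> (forall k, k \notin B -> w k = 0) ->
  (forall a b, gens S (a^-1 * b)%g -> `|w a - w b| <= 1) ->
  edge_path S x y l ->
  `|\sum_(k <- B) x k * w k - \sum_(k <- B) y k * w k| <= l.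
Proof.
move=> uB wB wS; elim=> {x y l} [x|a b s t y l Sab _ _ _ IH].
  by rewrite subrr normr0.
apply: le_trans (ler_distD (\sum_(k <- B) edge_point a b t k * w k) _ _) _.
rewrite lerD// !sum_edge_point//.
have -> : (1 - s) * w a + s * w b - ((1 - t) * w a + t * w b)
    = (t - s) * (w a - w b) by lra.
by rewrite normrM distrC ler_piMr// wS.
Qed.

Lemma edge_path_wgeodesic p i n :
  (forall j, (j < n)%N -> gens S ((p j)^-1 * p j.+1)%g) -> (i <= n)%N ->
  edge_path S (edge_point (p i) (p i) 0) (edge_point (p n) (p n) 0)
    (n%:R - i%:R : R).
Proof.
move=> pS; elim: n pS => [|n IH] pS.
  by rewrite leqn0 => /eqP ->; rewrite subrr; apply: edge_path_nil.
rewrite leq_eqVlt => /orP[/eqP ->|].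
  by rewrite subrr; apply: edge_path_nil.
rewrite ltnS => ni.
have -> : n.+1%:R - i%:R = (n%:R - i%:R) + `|0 - 1| :> R.
  by rewrite sub0r normrN normr1 -natr1; lra.
apply: edge_path_cat (IH _ ni) _ => [j jn|]; first by apply: pS; rewrite ltnW.
rewrite -(edge_point0 R (p n) (p n.+1)) -(edge_point1 R (p n)).
by apply: edge_path1; [exact: pS|rewrite lexx ler01|rewrite lexx ler01].
Qed.

Lemma cayley_dist_le (x y : cayley_graph R S) l :
  edge_path S (val x) (val y) l -> mdist x y <= l.
Proof. by move=> xy; apply: ge_inf (edge_path_lbound S _ _) _ xy. Qed.

(** The lower bound tests edge paths against the affine extension of a
    1-Lipschitz weight on the vertices, as in [edge_path_lipschitz]. *)
Lemma mdist_vertex (g h : G) :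
  mdist (vertex R S g) (vertex R S h) = (d g h)%:R.
Proof.
apply/le_anti/andP; split.
  have [p [p0 pn _] pS] := wgeodesic_exists S g h.
  have := edge_path_wgeodesic pS (leq0n _).
  rewrite p0 pn subr0.
  exact: (@cayley_dist_le (vertex R S g) (vertex R S h)).
have [B BP] := finite_wballP S (d g h).
(* The distance to [g], truncated at [d g h] and shifted by [- d g h] so as to
   have finite support. *)
pose w k : R := - ((d g h - d g k)%N)%:R.
pose B' := undup [seq (g * k)%g | k <- B].
have wB k : k \notin B' -> w k = 0.
  move=> kB; have dgk : (d g h < d g k)%N.
    rewrite ltnNge; apply: contra kB => /BP kB; rewrite mem_undup.
    by apply/mapP; exists (g^-1 * k)%g; rewrite ?mulVKg.
  by rewrite /w (_ : (d g h - d g k)%N = 0%N) ?mulr0n ?oppr0//; lia.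
have wS a b : gens S (a^-1 * b)%g -> `|w a - w b| <= 1.
  move=> /wlen_gens; rewrite -/(d a b) => ab.
  have := wdist_triangle S a g b; have := wdist_triangle S b g a.
  rewrite (wdistC S b a) /w opprK addrC => gba gab.
  have [le|/ltnW le] := leqP (d g a) (d g b); first rewrite distrC;
    by rewrite -natrB ?normr_nat ?ler1n; [rewrite (ler_nat R _ 1); lia|lia].
apply: lb_le_inf (cayley_pathsP _ _) _ => l /= gh.
have := edge_path_lipschitz (undup_uniq _) wB wS gh.
rewrite !sum_edge_point ?undup_uniq// !subr0 !mul1r !mul0r !addr0.
by rewrite /w wdistxx subnn subn0 oppr0 subr0 normrN normr_nat.
Qed.

Lemma four_point_hyperbolic :
  gromov_hyperbolic (cayley_graph R S) -> exists delta, four_point S delta.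
Proof.
move=> [delta d0 hyp]; exists (Num.bound (2 * delta)) => x y z w.
have := hyp (vertex R S x) (vertex R S y) (vertex R S z) (vertex R S w).
have b := archi_boundP (mulr_ge0 (ler0n R 2) d0).
rewrite /gromov_product !mdist_vertex -(ler_nat R).
have maxE m n : (maxn m n)%:R = Num.max m%:R n%:R :> R.
  by have [mn|/ltnW mn] := leqP m n;
    [rewrite max_r|rewrite max_l]; rewrite ?ler_nat.
rewrite !natrD maxE !natrD (wdistC S y z).
by rewrite minEle maxEle; case: ifP; case: ifP; lra.
Qed.

(** The arc-length parametrization of the edge path with successive vertices
    [p 0], [p 1], and so on. The vertex [x0] is a default value, used where
    these data do not define a point of the Cayley graph. *)
Definition realization (x0 : G) (p : nat -> G) (t : R) : cayley_graph R S :=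
  insubd (vertex R S x0 : set_type (cayley_points S))
    (edge_point (p (Num.truncn t)) (p (Num.truncn t).+1)
      (t - (Num.truncn t)%:R)).

Section Realization.
Context (x0 : G) (p : nat -> G) (n : nat).
Context (pS : forall j, (j < n)%N -> gens S ((p j)^-1 * p j.+1)%g).

Lemma val_realization t : 0 <= t <= n%:R ->
  val (realization x0 p t) =
  edge_point (p (Num.truncn t)) (p (Num.truncn t).+1) (t - (Num.truncn t)%:R).
Proof.
move=> /andP[t0 tn]; rewrite /realization [LHS]insubdK//; apply/mem_set.
have /andP[t1 t2] := truncn_itv t0.
have [jn|] := ltnP (Num.truncn t) n.
  exists (p (Num.truncn t)), (p (Num.truncn t).+1), (t - (Num.truncn t)%:R).
  split=> //; first by right; apply: pS.
  by rewrite -natr1 in t2; lra.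
rewrite -(ler_nat R) => nt; have -> : t - (Num.truncn t)%:R = 0 by lra.
rewrite edge_point0; exists (p (Num.truncn t)), (p (Num.truncn t)), 0.
by split; [left|lra|].
Qed.

Lemma realization_nat i :
  (i <= n)%N -> realization x0 p i%:R = vertex R S (p i).
Proof.
move=> ni; apply: val_inj; rewrite val_realization ?ler0n ?ler_nat//.
by rewrite natrK subrr edge_point0.
Qed.

Lemma realization_path s t : 0 <= s <= t -> t <= n%:R ->
  edge_path S (val (realization x0 p s)) (val (realization x0 p t)) (t - s).
Proof.
move=> /andP[s0 st] tn; have t0 := le_trans s0 st.
rewrite !val_realization ?t0 ?s0 ?(le_trans st)//.
have /andP[s1 s2] := truncn_itv s0; have /andP[t1 t2] := truncn_itv t0.
have : (Num.truncn s <= Num.truncn t)%N.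
  by rewrite truncn_ge_nat// (le_trans s1).
have : (Num.truncn t <= n)%N by rewrite -(ler_nat R) (le_trans t1).
move: (Num.truncn s) (Num.truncn t) s1 s2 t1 t2 => i j.
rewrite -!natr1 => s1 s2 t1 t2 jn; rewrite leq_eqVlt => /orP[/eqP ij|ij].
  subst j; have -> : t - s = `|(s - i%:R) - (t - i%:R)|.
    by rewrite ler0_norm; lra.
  have [lin|nli] := ltnP i n; first by apply: edge_path1; [exact: pS|lra|lra].
  have ts : t = s by rewrite -(ler_nat R) in nli; lra.
  by rewrite ts subrr normr0; apply: edge_path_nil.
have iS : gens S ((p i)^-1 * p i.+1)%g by apply: pS; lia.
have -> : t - s = `|(s - i%:R) - 1| + ((j%:R - i.+1%:R) + `|0 - (t - j%:R)|).
  by rewrite (@ler0_norm _ (s - _ - 1)) ?(@ler0_norm _ (0 - _)) -?natr1; lra.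
apply: edge_path_cons (_ : edge_path S _ _ _) => //;
  rewrite ?lexx ?ler01//; first by lra.
rewrite edge_point1; apply: edge_path_cat.
  by apply: edge_path_wgeodesic ij => k kj; apply: pS; lia.
rewrite -(edge_point0 R (p j) (p j.+1)).
have [ljn|nlj] := ltnP j n.
  by apply: edge_path1; [exact: pS|rewrite lexx ler01|lra].
have -> : t - j%:R = 0 by rewrite -(ler_nat R) in nlj; lra.
by rewrite subrr normr0; apply: edge_path_nil.
Qed.

Lemma realization_geodesic : d (p 0) (p n) = n ->
  geodesic (realization x0 p) n%:R (vertex R S (p 0)) (vertex R S (p n)).
Proof.
move=> dn; split=> [||| s t]; rewrite ?ler0n ?(realization_nat (leqnn n))//.
  by rewrite -(realization_nat (leq0n n)).
rewrite !in_itv/= => /andP[s0 sn] /andP[t0 tn].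
wlog st : s t s0 sn t0 tn / s <= t.
  move=> H; have [st|/ltW ts] := leP s t; first exact: H.
  by rewrite metric_sym distrC; apply: H.
have stP u v : 0 <= u <= v -> v <= n%:R ->
    mdist (realization x0 p u) (realization x0 p v) <= v - u.
  by move=> uv vn; apply: cayley_dist_le (realization_path uv vn).
rewrite ler0_norm ?opprB; last by lra.
apply/le_anti/andP; split; first by apply: stP => //; rewrite s0.
have : mdist (realization x0 p 0) (realization x0 p n%:R) = n%:R.
  by rewrite -[0 in LHS]/(0%:R) !realization_nat// mdist_vertex dn.
have := stP 0 s; have := stP t n%:R.
rewrite !lexx s0 t0 sn tn => /(_ isT isT) + /(_ isT isT).
have tri u v w := @metric_triangle R _ (realization x0 p u)
  (realization x0 p v) (realization x0 p w).
by have := tri 0 s n%:R; have := tri s t n%:R; lra.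
Qed.

End Realization.

(** Quasiconvexity in terms of the word metric; a single geodesic for each pair of
    points of [A] is enough. *)
Lemma quasiconvex_wgeodesic (A : set G) : quasiconvex R S A -> exists e,
  forall a b, A a -> A b -> exists2 p, wgeodesic S p a b &
    (forall j, (j < d a b)%N -> gens S ((p j)^-1 * p j.+1)%g) /\
    (forall i, (i <= d a b)%N -> exists2 c, A c & (d (p i) c <= e)%N).
Proof.
move=> [eps eps0 qA]; exists (Num.bound eps) => a b Aa Ab.
have [p pab pS] := wgeodesic_exists S a b; exists p => //; split=> // i iab.
have [p0 pn _] := pab.
have := realization_geodesic a pS; rewrite p0 pn.
move=> /(_ erefl) /(qA _ _ _ _ Aa Ab).
have pi : ((realization a p) @` `[0, (d a b)%:R]) (vertex R S (p i)).
  exists i%:R; first by rewrite /= in_itv/= ler0n ler_nat.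
  exact: (realization_nat a pS).
move=> /(_ _ pi)[_ [c Ac <-]]; rewrite mdist_vertex => pic; exists c => //.
by rewrite -(ler_nat R) (le_trans pic)// ltW// archi_boundP.
Qed.

End CayleyDistance.

(** * Infinite unions of finitely many conjugacy classes *)

(** The elements given by [infinite_order] lie in a fixed finite ball, so one of
    them has all its positive powers different from [1]. *)
Lemma reflections_virtually_cyclic (G : groupType) (T : generating_set G)
    (delta : nat) (A : set G) :
  four_point T delta ->
  (forall a g, A a -> A (a ^ g)%g) ->
  (exists m, forall a, A a -> exists k, wdist T k (a * k)%g <= m) ->
  (exists e, forall a b w, A a -> A b ->
    wdist T a w + wdist T w b = wdist T a b ->
    exists2 c, A c & wdist T w c <= e) ->
  infinite_set A -> virtually_cyclic G.
Proof.
move=> hyp conjA fixA qcA infA.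
have [r rP] := infinite_order hyp conjA fixA qcA infA.
have [b [e [z zP]]] := sphere_code hyp conjA fixA qcA infA.
suff [h hP] : exists h : G, forall i, 0 < i -> (h ^+ i)%g != 1%g.
  by exists h; apply: bounded_spheres_finite_index zP hP.
apply: contrapT => torsion.
have /choice[tor torP] : forall h : G, exists i, 0 < i /\ (h ^+ i)%g = 1%g.
  move=> h; apply: contrapT => ho; apply: torsion; exists h => i i0.
  by apply/eqP => hi; apply: ho; exists i.
have [B BP] := finite_wballP T r.
have [h /BP hB h1] := rP (\max_(h <- B) tor h).
have [t0 th] := torP h; have /eqP[] : (h ^+ tor h)%g != 1%g; last exact: th.
apply: h1; rewrite t0 /=.
exact: (@leq_bigmax_seq _ B xpredT).
Qed.

Lemma conjugacy_unionJ (G : groupType) (A : set G) (a g : G) :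
  finite_union_of_conjugacy_classes A -> A a -> A (a ^ g)%g.
Proof.
move=> [F _ ->] [x Fx [h _ <-]]; exists x => //.
by exists (h * g)%g; rewrite ?conjgM.
Qed.

(** The conjugate [x ^ g] moves [g^-1] by the length of [x]. *)
Lemma conjugacy_union_displacement (G : groupType) (T : generating_set G)
    (A : set G) : finite_union_of_conjugacy_classes A ->
  exists m, forall a, A a -> exists k, wdist T k (a * k)%g <= m.
Proof.
move=> [F /finite_seqP[B ->] ->]; exists (\max_(x <- B) wlen T x).
move=> _ [x /= xB [g _ <-]]; exists (g^-1)%g.
rewrite conjgE -!mulgA mulgV mulg1 wdistMr.
exact: (@leq_bigmax_seq _ B xpredT).
Qed.

(** Quasiconvexity passes from a generating set [S] to a generating set [T] whose
    word metric is hyperbolic: geodesics of [S] are quasi-geodesics of [T], so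
    geodesics of [T] stay close to them. *)
Lemma quasiconvex_hyperbolic (R : realType) (G : groupType)
    (S T : generating_set G) (delta : nat) (A : set G) :
  four_point T delta -> quasiconvex R S A ->
  exists e, forall a b w, A a -> A b ->
    wdist T a w + wdist T w b = wdist T a b ->
    exists2 c, A c & wdist T w c <= e.
Proof.
move=> hyp /quasiconvex_wgeodesic[e eA].
have [c1 c1P] := wlen_lipschitz S T; have [c2 c2P] := wlen_lipschitz T S.
have [r rP] := geodesic_near_quasigeodesic hyp (maxn c1 c2).
exists (r + c1 * e) => a b w Aa Ab.
have [p [p0 pn pij] [pS pA]] := eA a b Aa Ab; move=> awb.
have [i jn|i j ijn||i ile wi] := rP (wdist S a b) p _ _ w _.
- apply: leq_trans (c1P _) _; have := wlen_gens (pS i jn).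
  by case: (wlen S _) => [|[|//]] _; rewrite ?muln0// muln1 leq_maxl.
- rewrite -(pij i j ijn); apply: leq_trans (c2P _) _.
  by rewrite leq_mul2r leq_maxr orbT.
- by rewrite p0 pn.
have [c Ac ic] := pA i ile; exists c => //.
apply: leq_trans (wdist_triangle T (p i) _ _) (leq_add wi _).
by apply: leq_trans (c1P _) _; rewrite leq_mul2l ic orbT.
Qed.

Theorem theorem3 (R : realType) (G : groupType) (A : set G)
  (hyperbolicG : hyperbolic_group R G)
  (non_elementaryG : non_elementary G)
  (unionA : finite_union_of_conjugacy_classes A)
  (infiniteA : infinite_set A)
  (S : generating_set G) :
  ~ quasiconvex R S A.
Proof.
move=> qA; apply: non_elementaryG.
have [T /four_point_hyperbolic[delta hyp]] := hyperbolicG.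
apply: (reflections_virtually_cyclic hyp _ _ _ infiniteA).
- by move=> a g; apply: conjugacy_unionJ.
- exact: conjugacy_union_displacement.
- exact: quasiconvex_hyperbolic hyp qA.
Qed.
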